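(* Let $P(z)=\sum_{j=0}^d a_jz^j\in\mathbb{C}[X]$ be a polynomial of degree $d\ge1$ with $a_0\ne0$, and let $p\in\mathbb{N}^*$ be a bit precision. Let $\mathrm{FPE}_p$ be the two-phase evaluation algorithm described in the context. The preconditioning phase of $\mathrm{FPE}_p$ is performed on $P$ in time $d+2d\log_2 d$ and requires $O(dp)$ in memory. Subsequently, for $z$ uniformly distributed on the Riemann sphere $\overline{\mathbb{C}}$, the average evaluation time of $P(z)$ by $\mathrm{FPE}_p$ is less than $$2+3\log_2 d+\Big(2\log_2 d+1.9046\sqrt{d(p+\log_2 d+4)}\Big)M(p),$$ where $M(p)$ denotes the time of one multiplication followed by an addition of two floating-point numbers with precision $p$. If $P\in\mathbb{R}[X]$ (of degree $d$) and $x$ is uniformly distributed on the circle $\overline{\mathbb{R}}=\mathbb{R}\cup\{\infty\}$, the average evaluation time of $P(x)$ by $\mathrm{FPE}_p$ is less than $$2+3\log_2 d+\Big(2\log_2 d+1.7673\sqrt{d(p+\log_2 d+4)}\Big)M(p).$$ In both cases, the bit complexity of the evaluation phase never exceeds $2+3\log_2 d+M(p)\,d$.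
   Context: Scale: $s(z)=1+\lfloor\log_2|z|\rfloor$ for $z\in\mathbb{C}^*$, $s(0)=-\infty$. $E_P(i)=s(a_i)$ for $i\in\{0,\ldots,d\}$, and $\widehat{E}_P$ is the concave cover of $E_P$: the minimal real concave function on $[0,d]$ with $E_P\le\widehat{E}_P$ on $\{0,\ldots,d\}$. Algorithm $\mathrm{FPE}_p$. Preconditioning (done once for $P$): (1) compute and sort the values $s(a_k)$, $0\le k\le d$ (counted as $d\log_2 d$ operations); (2) compute the concave piecewise linear map $\widehat{E}_P$ (counted as $d\log_2 d$, by $d$ binary-search insertions); (3) list $G_p=\{k\in\{0,\ldots,d\}:s(a_k)\ge\widehat{E}_P(k)-p-s(d)-3\}$ (counted as $d$ operations). Evaluation at $z\in\mathbb{C}^*$: (a) compute $\lambda=\log_2|z|$ (1 operation); (b) compute $k_\lambda$, a maximizer of the concave map $x\mapsto\widehat{E}_P(x)+\lambda x$, by binary search ($\log_2 d$ operations); (c) compute $N=\widehat{E}_P(k_\lambda)+\lambda k_\lambda$ (1 operation); (d) by two binary searches ($2\log_2 d$ operations) compute $\ell\le r$ such that $\{\ell,\ldots,r\}$ is the largest integer interval contained in $\{k\in\{0,\ldots,d\}:\widehat{E}_P(k)+\lambda k\ge N-p-s(d)-3\}$; (e) compute and output $Q_\lambda(z)=\sum_{k\in G_p\cap\{\ell,\ldots,r\}}a_kz^k$ with precision $p$, by computing the power $z^\ell$ by repeated squaring (at most $2\log_2\ell$ multiplications) and applying Hörner's scheme to the remaining factor. Cost conventions: one arithmetic operation is one multiplication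 followed by one addition; each arithmetic operation on $p$-bit numbers in step (e) costs $M(p)$ bit operations; operations in steps (a)–(d) and in preconditioning are done on machine numbers and have unit cost. Averages: uniform distribution on $\overline{\mathbb{C}}$ means the probability measure $\frac{dx\,dy}{\pi(1+x^2+y^2)^2}$, $z=x+iy$; uniform distribution on $\overline{\mathbb{R}}$ means $\frac{dx}{\pi(1+x^2)}$. *)

(* Defs.v *)
(* MathComp / MathComp-Analysis; C is R[i] over an arbitrary R : realType *)
From Corelib Require Import BinNums.
From HB Require Import structures.
From mathcomp Require Import all_boot all_order all_algebra.
From mathcomp Require Import all_classical all_reals all_analysis.
From mathcomp Require Import complex ring lra.
Set Implicit Arguments.
Unset Strict Implicit.
Unset Printing Implicit Defensive.
Import Order.TTheory GRing.Theory Num.Theory.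
Import numFieldNormedType.Exports.
Local Open Scope classical_set_scope.
Local Open Scope ring_scope.
Local Open Scope complex_scope.

Definition log2 {R : realType} (x : R) : R := ln x / ln 2.

Section Scale.
Context {R : realType}.
Implicit Types (z : R[i]) (P : {poly R[i]}) (g : R -> R).

Definition scale z : \bar R :=
  if z == 0 then -oo%E
  else (1 + (Num.floor (log2 (Normc.normc z)))%:~R)%:E.

Definition degree P : nat := (size P).-1.

Definition concave_function (D : set R) g :=
  @convex_function R R^o D (fun x : R => - g x).

Definition concave_majorant P g :=
  concave_function `[0, (degree P)%:R] g /\
  forall k, (k <= degree P)%N -> (scale P`_k <= (g k%:R)%:E)%E.

Definition is_concave_cover P g :=
  concave_majorant P g /\
  forall h, concave_majorant P h ->
    {in `[0, (degree P)%:R]%R, forall x, g x <= h x}.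

Definition concave_cover P : R -> R := xget (fun=> 0) (is_concave_cover P).

(* y - p - s(d) - 3 *)
Definition threshold (p d : nat) (y : R) : \bar R :=
  (y%:E - p%:R%:E - scale d%:R - 3%:E)%E.

End Scale.

(* A computation together with the time charged for it. *)
Section Timed.
Context {R : realType}.

Definition timed (A : Type) : Type := A * R.
Definition outcome {A} (m : timed A) : A := m.1.
Definition time {A} (m : timed A) : R := m.2.
Definition charge {A} (t : R) (a : A) : timed A := (a, t).
Definition bind {A B} (m : timed A) (f : A -> timed B) : timed B :=
  (outcome (f (outcome m)), time m + time (f (outcome m))).

End Timed.
Arguments timed R A : clear implicits.

Section Preconditioning.
Context {R : realType}.
Implicit Types (P : {poly R[i]}) (p : nat).

(* [cover_map] is represented in memory by [cover_vertices], the list of the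
   vertices (k, cover_map k) of its graph, between which it is affine. *)
Record fpe_table := FpeTable {
  sorted_scales : seq (nat * \bar R);
  cover_map : R -> R;
  cover_vertices : seq (nat * R);
  good_indices : seq nat }.

Definition sort_scales P : seq (nat * \bar R) :=
  sort (fun u v => (v.2 <= u.2)%E)
       [seq (k, scale P`_k) | k <- iota 0 (degree P).+1].

Definition is_vertex (d : nat) (g : R -> R) (k : nat) : bool :=
  [|| k == 0%N, k == d | g k.-1%:R + g k.+1%:R < 2 * g k%:R].

Definition vertices (d : nat) (g : R -> R) : seq (nat * R) :=
  [seq (k, g k%:R) | k <- iota 0 d.+1 & is_vertex d g k].

Definition good_set P p (g : R -> R) : seq nat :=
  [seq k <- iota 0 (degree P).+1
     | (threshold p (degree P) (g k%:R) <= scale P`_k)%E].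

Definition FPE_precondition P p : timed R fpe_table :=
  let d := degree P in
  bind (charge (d%:R * log2 d%:R) (sort_scales P)) (fun s =>
  bind (charge (d%:R * log2 d%:R)
          (concave_cover P, vertices d (concave_cover P))) (fun Ev =>
  bind (charge d%:R (good_set P p Ev.1)) (fun G =>
  charge 0 (FpeTable s Ev.1 Ev.2 G)))).

(* Memory, in bits, when a machine number (an index, a scale, an exponent, an
   ordinate of the cover) takes w bits, and a coefficient of P is a pair of
   floating-point numbers with p-bit significands and machine exponents. *)
Definition FPE_memory (w : nat) P p : nat :=
  let T := outcome (FPE_precondition P p) in
  (size P * (2 * (p + w)) +
   w * (2 * size (sorted_scales T) + 2 * size (cover_vertices T) +
        size (good_indices T)))%N.

End Preconditioning.
Arguments fpe_table R : clear implicits.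

Section Evaluation.
Context {R : realType}.
(* [fl x y c] is the value computed for x * y + c by the arithmetic in use,
   i.e. one arithmetic operation; nothing is assumed about its rounding.  The
   natural number in the results below counts these operations. *)
Variable fl : R[i] -> R[i] -> R[i] -> R[i].

Fixpoint power_pos (z : R[i]) (n : positive) : R[i] * nat :=
  match n with
  | xH => (z, 0%N)
  | xO m => let: (y, c) := power_pos z m in (fl y y 0, c.+1)
  | xI m => let: (y, c) := power_pos z m in (fl (fl y y 0) z 0, c.+2)
  end.

(* b_l + b_(l+1) z + ... + b_(l+n) z^n *)
Fixpoint horner_scheme (b : nat -> R[i]) (z : R[i]) (l n : nat) : R[i] * nat :=
  match n with
  | 0%N => (b l, 0%N)
  | m.+1 => let: (y, c) := horner_scheme b z l.+1 m in (fl y z (b l), c.+1)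
  end.

(* b_l z^l + ... + b_r z^r *)
Definition eval_range (b : nat -> R[i]) (z : R[i]) (l r : nat) : R[i] * nat :=
  let: (h, c) := horner_scheme b z l (r - l) in
  match bin_of_nat l with
  | N0 => (h, c)
  | Npos n => let: (y, c') := power_pos z n in (fl y h 0, (c' + c).+1)
  end.

Definition is_maximizer (D : set R) (g : R -> R) (x : R) :=
  D x /\ forall y, D y -> g y <= g x.

Definition is_largest_interval (S : pred nat) (lr : nat * nat) :=
  let sub i j := forall k, (i <= k <= j)%N -> S k in
  [/\ (lr.1 <= lr.2)%N, sub lr.1 lr.2 &
      forall i j, (i <= j)%N -> sub i j -> (lr.1 <= i)%N /\ (j <= lr.2)%N].

Definition in_strip (d p : nat) (g : R -> R) (lam N : R) : pred nat :=
  fun k => (k <= d)%N &&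
    (threshold p d N <= (g k%:R + lam * k%:R)%:E)%E.

(* Mp is the time M(p) of one operation [fl]. *)
Definition FPE_evaluate (p : nat) (Mp : R) (P : {poly R[i]})
    (T : fpe_table R) (z : R[i]) : timed R R[i] :=
  let d := degree P in
  let E := cover_map T in
  bind (charge 1 (log2 (Normc.normc z))) (fun lam =>
  bind (charge (log2 d%:R)
          (xget 0 (is_maximizer `[0, d%:R] (fun x => E x + lam * x)))) (fun k =>
  bind (charge 1 (E k + lam * k)) (fun N =>
  bind (charge (2 * log2 d%:R)
          (xget (0%N, 0%N) (is_largest_interval (in_strip d p E lam N))))
       (fun lr =>
  let b k := if k \in good_indices T then P`_k else 0 in
  let: (y, c) := eval_range b z lr.1 lr.2 in
  charge (c%:R * Mp) y)))).

Definition FPE_time (p : nat) (Mp : R) (P : {poly R[i]}) (z : R[i]) : R :=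
  time (FPE_evaluate p Mp P (outcome (FPE_precondition P p)) z).

End Evaluation.

Section Averages.
Context {R : realType}.

Definition sphere_density (x y : R) : R := (pi * (1 + x ^+ 2 + y ^+ 2) ^+ 2)^-1.
Definition circle_density (x : R) : R := (pi * (1 + x ^+ 2))^-1.

Definition sphere_integrand (f : R[i] -> R) (w : R * R) : \bar R :=
  (f (w.1 +i* w.2) * sphere_density w.1 w.2)%:E.
Definition circle_integrand (f : R -> R) (x : R) : \bar R :=
  (f x * circle_density x)%:E.

Definition sphere_integrable (f : R[i] -> R) :=
  (lebesgue_measure \x lebesgue_measure)%E.-integrable setT (sphere_integrand f).
Definition circle_integrable (f : R -> R) :=
  lebesgue_measure.-integrable setT (circle_integrand f).

Definition sphere_mean (f : R[i] -> R) : \bar R :=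
  (\int[lebesgue_measure \x lebesgue_measure]_w sphere_integrand f w)%E.
Definition circle_mean (f : R -> R) : \bar R :=
  (\int[lebesgue_measure]_x circle_integrand f x)%E.

End Averages.

Section Consistency.
Context {R : realType}.

Let exact (x y c : R[i]) := x * y + c.

Lemma power_pos_exact z n :
  (power_pos exact z n).1 = z ^+ nat_of_pos n.
Proof.
elim: n => [n IH|n IH|]; last by rewrite expr1.
- move: IH; rewrite /=; case: (power_pos _ _ _) => y c /= ->.
  by rewrite /exact !addr0 -exprD -exprSr NatTrec.doubleE addnn.
- move: IH; rewrite /=; case: (power_pos _ _ _) => y c /= ->.
  by rewrite /exact !addr0 -exprD NatTrec.doubleE addnn.
Qed.

Lemma horner_scheme_exact b z l n :
  (horner_scheme exact b z l n).1 = \sum_(i < n.+1) b (l + i)%N * z ^+ i.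
Proof.
elim: n l => [|n IH] l; first by rewrite big_ord1 addn0 mulr1.
rewrite big_ord_recl addn0 mulr1 /=; move: (IH l.+1).
case: (horner_scheme _ _ _ _ _) => y c /= ->.
rewrite /exact addrC mulr_suml; congr (_ + _); apply: eq_bigr => i _.
by rewrite /= /bump add1n addnS exprSr mulrA.
Qed.

(* With exact operations the evaluation phase computes the truncated sum. *)
Lemma eval_range_exact b z l r : (l <= r)%N ->
  (eval_range exact b z l r).1 = \sum_(l <= k < r.+1) b k * z ^+ k.
Proof.
move=> lr; rewrite -{2}[l]add0n big_addn big_mkord subSn // /eval_range.
have := horner_scheme_exact b z l (r - l).
case: (horner_scheme _ _ _ _ _) => h c /= ->.
under eq_bigr => i _ do rewrite addnC.
case: (bin_of_nat l) (bin_of_natK l) => [|n] /= nl.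
  by rewrite -nl; apply: eq_bigr => i _; rewrite !addn0.
have := power_pos_exact z n.
case: (power_pos _ _ _) => y c' /= ->; rewrite nl /exact addr0 mulr_sumr.
by apply: eq_bigr => i _; rewrite mulrCA -exprD (addnC i l).
Qed.

Lemma concave_functionP (D : set R) (g : R -> R) :
  concave_function D g <->
  (forall x y t : R, D x -> D y -> 0 <= t <= 1 ->
     t * g x + (1 - t) * g y <= g (t * x + (1 - t) * y)).
Proof.
split=> [h x y t Dx Dy /andP[t0 t1]|h t x y /set_mem Dx /set_mem Dy].
  have /= := h (Itv01 t0 t1) x y (mem_set Dx) (mem_set Dy).
  rewrite [X in g X](convRE x y) [leRHS](convRE (- g x)) /= /unstable.onem.
  lra.
rewrite [X in g X](convRE x y) [leRHS](convRE (- g x)) /= /unstable.onem.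
have := h x y t%:num Dx Dy.
have -> : 0 <= t%:num <= 1 by apply/andP; split.
move=> /(_ isT).
lra.
Qed.

(* The minimum defining [concave_cover] exists. *)
Lemma concave_coverP (P : {poly R[i]}) : P`_0 != 0 -> P != 0 ->
  is_concave_cover P (concave_cover P).
Proof.
move=> P0 Pn0; set d := degree P.
have scaleE k : P`_k != 0 -> scale P`_k = (fine (scale P`_k))%:E.
  by rewrite /scale => /negbTE ->.
have lead : P`_d != 0 by rewrite -lead_coefE lead_coef_eq0.
pose e0 := fine (scale P`_0); pose ed := fine (scale P`_d).
have lbm (h : R -> R) x : concave_majorant P h -> 0 <= x <= d%:R ->
    Num.min e0 ed <= h x.
  move=> [/concave_functionP hc hm] /andP[x0 xd].
  have h0 : e0 <= h 0 by have := hm 0%N isT; rewrite scaleE // lee_fin.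
  have hd : ed <= h d%:R by have := hm d (leqnn d); rewrite scaleE // lee_fin.
  have m0 : Num.min e0 ed <= h 0 by rewrite ge_min h0.
  have md : Num.min e0 ed <= h d%:R by rewrite ge_min hd orbT.
  have [d0|dn0] := eqVneq (d%:R : R) 0.
    by have -> : x = 0 by apply/le_anti; rewrite x0 -d0 xd.
  have dp : 0 < d%:R :> R by rewrite lt_neqAle eq_sym dn0 ler0n.
  have t0 : 0 <= x / d%:R by rewrite divr_ge0 // ltW.
  have t1 : x / d%:R <= 1 by rewrite ler_pdivrMr // mul1r.
  have := hc d%:R 0 (x / d%:R).
  rewrite /= !in_itv /= !lexx !ler0n t0 t1 mulr0 addr0 mulfVK //.
  move=> /(_ isT isT isT); apply: le_trans.
  by nra.
pose M := \sum_(k < d.+1) `|fine (scale P`_k)|.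
have cM : concave_majorant P (fun=> M).
  split; first by apply/concave_functionP => x y t _ _ _; nra.
  move=> k kd; rewrite /scale; case: ifPn => [_|Pk]; first by rewrite leNye.
  rewrite lee_fin; apply: (@le_trans _ _ `|fine (scale P`_k)|).
    by rewrite /scale (negbTE Pk) /= ler_norm.
  rewrite /M (bigD1 (Ordinal (kd : (k < d.+1)%N))) //= lerDl.
  by apply: sumr_ge0.
pose F x := [set h x | h in concave_majorant P].
have Fne x : F x !=set0 by exists M, (fun=> M).
have Flb (h : R -> R) x : concave_majorant P h -> 0 <= x <= d%:R ->
    inf (F x) <= h x.
  move=> ch xd; apply: ge_inf; last by exists h.
  by exists (Num.min e0 ed) => _ [k ck <-]; apply: lbm.
rewrite /concave_cover; apply: xgetPex; exists (fun x => inf (F x)); split.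
  split.
    apply/concave_functionP => x y t.
    rewrite /= !in_itv /= => xd yd /andP[t0 t1].
    apply: lb_le_inf => // _ [h ch <-].
    have hx := Flb h x ch xd; have hy := Flb h y ch yd.
    case: (ch) => /concave_functionP /(_ x y t) + _.
    rewrite /= !in_itv /= t0 t1 => /(_ xd yd isT); apply: le_trans.
    by apply: lerD; apply: ler_wpM2l => //; rewrite subr_ge0.
  move=> k kd; rewrite /scale; case: ifPn => [_|Pk]; first by rewrite leNye.
  rewrite lee_fin; apply: lb_le_inf => // _ [h [_ hm] <-]; move: (hm k kd).
  by rewrite /scale (negbTE Pk) lee_fin.
by move=> h ch x; rewrite in_itv /=; exact: Flb.
Qed.

End Consistency.

(* Main.v *)
(* Step (e) costs at most 2 log2 d + (r - l + 1) operations, so everything rests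
   on the mean width of the strip {l, ..., r}.  Write Delta = p + s(d) + 3 and
   lam = log2 |z|.  If k and k + m both lie in the strip then lam is within
   Delta / m of (E k - E (k + m)) / m; hence for every m >= 1 the width is at
   most m plus the number of k <= d - m having this property.  The law of lam has
   a density bounded by K, with K = ln 2 / 2 on the sphere and K = ln 2 / pi on
   the circle, so the mean width is at most m + (d + 1 - m) 2 K Delta / m, and m
   is chosen close to c sqrt (d (p + log2 d + 4)) / 2, c being the constant of the
   theorem.  If d is too small for this choice the cost d of the worst case is
   already below the bound. *)

Require Import Defs.
From HB Require Import structures.
From mathcomp Require Import all_boot all_order all_algebra.
From mathcomp Require Import all_classical all_reals all_analysis.
From mathcomp Require Import measurable_realfun complex zify ring lra.
Set Implicit Arguments.
Unset Strict Implicit.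
Unset Printing Implicit Defensive.
Import Order.TTheory GRing.Theory Num.Theory.
Import numFieldNormedType.Exports.
Local Open Scope classical_set_scope.
Local Open Scope ring_scope.
Local Open Scope complex_scope.

(** * Operation counts *)

Section Log2.
Context {R : realType}.

Lemma ln2_gt0 : 0 < ln 2 :> R.
Proof. by apply: ln_gt0; rewrite ltr1n. Qed.

Lemma log2_ge0 (d : nat) : (1 <= d)%N -> 0 <= log2 d%:R :> R.
Proof.
by move=> d1; apply: divr_ge0; [apply: ln_ge0; rewrite ler1n|rewrite ltW ?ln2_gt0].
Qed.

Lemma log2_le (x y : R) : 0 < x -> x <= y -> log2 x <= log2 y.
Proof.
move=> x0 xy; rewrite ler_pM2r ?invr_gt0 ?ln2_gt0 //.
by rewrite ler_ln // posrE // (lt_le_trans x0).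
Qed.

Lemma log2_expn (n c : nat) : (0 < n)%N -> log2 (n ^ c)%:R = c%:R * log2 n%:R :> R.
Proof.
by move=> n0; rewrite /log2 natrX lnXn ?ltr0n // mulrA mulr_natl.
Qed.

Lemma log2_2 : log2 2 = 1 :> R.
Proof. by rewrite /log2 divff // gt_eqF // ln2_gt0. Qed.

End Log2.

Section OperationCount.
Context {R : realType}.
Variable fl : R[i] -> R[i] -> R[i] -> R[i].

(** The strict bound leaves room for the product of the power by the Hörner value in
    [eval_cost_le]. *)
Lemma power_pos_count_lt z n :
  ((power_pos fl z n).2 < nat_of_pos n)%N.
Proof.
elim: n => [n|n|] /=; [| |by []]; case: (power_pos _ _ _) => y c /= IH;
  rewrite NatTrec.doubleE -addnn; lia.
Qed.

(** The bound of the count by [2 * log2 n], kept in integers: each further binary digit adds at most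
    two operations and multiplies [n ^ 2] by at least 4. *)
Lemma power_pos_count_exp z n :
  (2 ^ (power_pos fl z n).2 <= nat_of_pos n ^ 2)%N.
Proof.
elim: n => [n|n|] /=; [| |by []]; case: (power_pos _ _ _) => y c /= IH;
  rewrite NatTrec.doubleE -addnn !expnS; nia.
Qed.

Lemma horner_scheme_count b z l n : (horner_scheme fl b z l n).2 = n.
Proof.
by elim: n l => //= n IH l; move: (IH l.+1); case: horner_scheme => y c /= ->.
Qed.

End OperationCount.

Section EvaluationCost.
Context {R : realType}.

(** The number of operations depends on [l] and [r] only, so arbitrary arithmetic and data are
    plugged in. *)
Definition eval_cost (l r : nat) : nat :=
  (eval_range (fun _ _ _ : R[i] => 0) (fun=> 0) 0 l r).2.

Lemma power_pos_count_indep (fl fl' : R[i] -> R[i] -> R[i] -> R[i]) z z' n :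
  (power_pos fl z n).2 = (power_pos fl' z' n).2.
Proof.
by elim: n => //= n; case: power_pos => y c; case: power_pos => y' c' /= ->.
Qed.

Lemma eval_range_count fl b (z : R[i]) l r :
  (eval_range fl b z l r).2 = eval_cost l r.
Proof.
rewrite /eval_cost /eval_range.
have := horner_scheme_count fl b z l (r - l).
have := horner_scheme_count (fun _ _ _ : R[i] => 0) (fun=> 0) 0 l (r - l).
case: horner_scheme => h c /= ->; case: horner_scheme => h' c' /= ->.
case: (bin_of_nat l) => [//|n].
have := power_pos_count_indep fl (fun _ _ _ : R[i] => 0) z 0 n.
by case: power_pos => y e /=; case: power_pos => y' e' /= ->.
Qed.

(** Hörner takes [r - l] operations; for [l > 0] the power takes at most [l - 1] and the final
    product one more. *)
Lemma eval_cost_le l r : (l <= r)%N -> (eval_cost l r <= r)%N.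
Proof.
move=> lr; rewrite /eval_cost /eval_range.
have := horner_scheme_count (fun _ _ _ : R[i] => 0) (fun=> 0) 0 l (r - l).
case: horner_scheme => h c /= ->.
case: (bin_of_nat l) (bin_of_natK l) => [|n] /= nl; first by rewrite leq_subr.
have := power_pos_count_lt (fun _ _ _ : R[i] => 0) 0 n.
by case: power_pos => y e /=; rewrite nl; lia.
Qed.

(** The successor in [(r - l).+1] pays for the product of the power by the Hörner value. *)
Lemma eval_cost_log2 l r d : (1 <= d)%N -> (l <= r <= d)%N ->
  (eval_cost l r)%:R <= 2 * log2 d%:R + (r - l).+1%:R :> R.
Proof.
move=> d1 /andP[lr rd]; rewrite /eval_cost /eval_range.
have := horner_scheme_count (fun _ _ _ : R[i] => 0) (fun=> 0) 0 l (r - l).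
case: horner_scheme => h c /= ->.
have ld := @log2_ge0 R d d1.
case: (bin_of_nat l) (bin_of_natK l) => [|n] /= nl.
  by rewrite -natr1; lra.
have := power_pos_count_exp (fun _ _ _ : R[i] => 0) 0 n.
case: power_pos => y e /=; rewrite nl => le2.
rewrite -addnS natrD lerD2r.
have : (2 ^ e <= d ^ 2)%N by apply: (leq_trans le2); rewrite leq_sqr (leq_trans lr).
rewrite -(ler_nat R) => /(@log2_le R _ _); rewrite ltr0n expn_gt0 => /(_ isT).
by rewrite !log2_expn // log2_2 mulr1.
Qed.

End EvaluationCost.

(** * Polar coordinates *)

Section LebesgueScaling.
Context {R : realType}.
Local Notation mu := (@lebesgue_measure R).
Local Open Scope ereal_scope.

Lemma mulr_preimage_itv_oc (c a b : R) : (0 < c)%R ->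
  ( *%R c : R -> R) @^-1` `]a, b] = `](a / c)%R, (b / c)%R]%classic.
Proof.
move=> c0; apply/seteqP; split => x /=;
  by rewrite !in_itv /= ltr_pdivrMr // ler_pdivlMr // mulrC.
Qed.

(** [mu] is [c] times its pushforward under multiplication by [c]: the two agree on half-open
    intervals, which determine Lebesgue measure. *)
Lemma ge0_integral_scale (c : R) (f : R -> \bar R) : (0 < c)%R ->
  measurable_fun [set: R] f -> (forall x, 0 <= f x) ->
  \int[mu]_x f x = c%:E * \int[mu]_x f (c * x)%R.
Proof.
move=> c0 mf f0.
have mc : measurable_fun setT ( *%R c : measurableTypeR R -> measurableTypeR R).
  exact: mulrl_measurable.
pose cn := NngNum (ltW c0).
have mE A : measurable A ->
    mu A = mscale cn (pushforward mu ( *%R c : measurableTypeR R -> measurableTypeR R)) A.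
  apply: lebesgue_measure_unique => _ [[u v]] _ <-.
  rewrite /= /mscale /= /pushforward.
  rewrite (_ : _ @^-1` _ = `](u / c)%R, (v / c)%R]%classic); last exact: mulr_preimage_itv_oc.
  rewrite !lebesgue_measure_itv /=.
  rewrite !lte_fin ltr_pM2r ?invr_gt0 //; case: ifPn => _; last by rewrite mule0.
  by rewrite -EFinM; congr (_%:E); rewrite -mulrBl mulrC mulfVK // gt_eqF.
rewrite (eq_measure_integral _ (fun A mA _ => mE mc A mA)) //.
rewrite ge0_integral_mscale //; congr (_ * _).
by rewrite (ge0_integral_pushforward mc).
Qed.

Lemma ge0_integral_opp (f : R -> \bar R) :
  measurable_fun [set: R] f -> (forall x, 0 <= f x) ->
  \int[mu]_x f x = \int[mu]_x f (- x)%R.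
Proof.
move=> mf f0.
have mN : measurable_fun setT (-%R : measurableTypeR R -> measurableTypeR R).
  exact: oppr_measurable.
have <- := ge0_integral_pushforward mN mu measurableT mf (fun y _ => f0 y).
by apply: eq_measure_integral => A mA _; exact/esym/lebesgue_measureN.
Qed.

Lemma integralT_oneDsqrV : \int[mu]_x ((1 + x ^+ 2)^-1)%R%:E = pi%:E.
Proof.
rewrite (@ge0_symfun_integralT R (fun x => (1 + x ^+ 2)^-1)%R).
- by rewrite -set_itvcy integral0y_oneDsqr -EFinM; congr (_%:E); field.
- by move=> x; rewrite invr_ge0 addr_ge0 ?sqr_ge0.
- exact: continuous_oneDsqrV.
- by move=> x /=; rewrite sqrrN.
Qed.

(* Polar coordinates by linear substitutions only: put y = |x| u at fixed x,
   exchange the integrals, and put s = sqrt (1 + u^2) x at fixed u. *)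
Lemma ge0_integral_polar (f : R -> R) :
  measurable_fun [set: R] f -> (forall x, (0 <= f x)%R) ->
  \int[mu \x mu]_w (f (w.1 ^+ 2 + w.2 ^+ 2)%R)%:E =
  pi%:E * \int[mu]_s (f (s ^+ 2) * `|s|)%R%:E.
Proof.
move=> mf f0.
pose F (w : R * R) := (f (w.1 ^+ 2 + w.2 ^+ 2)%R)%:E.
pose H (w : R * R) := (`|w.1| * f (w.1 ^+ 2 * (1 + w.2 ^+ 2)))%R%:E.
have m1 : measurable_fun setT (fun w : R * R => w.1) by exact: measurable_fst.
have m2 : measurable_fun setT (fun w : R * R => w.2) by exact: measurable_snd.
have mF : measurable_fun setT F.
  apply/measurable_EFinP; apply: (measurableT_comp mf).
  by apply: measurable_funD; apply: measurable_funX.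
have mH : measurable_fun setT H.
  apply/measurable_EFinP; apply: measurable_funM.
    exact: (measurableT_comp (@normr_measurable _ _)).
  apply: (measurableT_comp mf); apply: measurable_funM.
    exact: measurable_funX.
  by apply: measurable_funD => //; exact: measurable_funX.
have F0 w : 0 <= F w by rewrite lee_fin.
have H0 w : 0 <= H w by rewrite lee_fin mulr_ge0.
have mFx x : measurable_fun setT (fun y => F (x, y)) by exact: measurable_fun_pair2.
transitivity (\int[mu]_x \int[mu]_u H (x, u)).
  rewrite fubini_tonelli1 //; apply: ge0_ae_eq_integral => //.
  - exact: measurable_fun_fubini_tonelli_F.
  - have := measurable_fun_fubini_tonelli_F (m2 := mu) H mH H0; exact.
  - by move=> x _; apply: integral_ge0 => y _; exact: F0.
  - by move=> x _; apply: integral_ge0 => y _; exact: H0.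
  (* The substitution [y = |x| u] degenerates only at [x = 0], a null set. *)
  exists [set 0%R]; split=> [//||x /= nFH]; first exact: lebesgue_measure_set1.
  apply: contrapT => /eqP x0; apply: nFH => _.
  have x1 : (0 < `|x|)%R by rewrite normr_gt0.
  rewrite /fubini_F (ge0_integral_scale x1 (mFx x) (fun y => F0 (x, y))).
  rewrite -ge0_integralZl //; last first.
    exact: (measurableT_comp (mFx x) (mulrl_measurable `|x|)).
  apply: eq_integral => u _; rewrite -EFinM; congr (_ * f _)%R%:E.
  by rewrite /= exprMn real_normK ?num_real // mulrDr mulr1.
rewrite fubini_tonelli //.
set K := \int[mu]_s _.
(* At fixed [u], [ds] and [|s|] each contribute a factor [sqrt (1 + u^2)], whence the weight
   [1 / (1 + u^2)], whose integral is [pi]. *)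
transitivity (\int[mu]_u (((1 + u ^+ 2)^-1)%R%:E * K)).
  apply: eq_integral => u _.
  have u1 : (0 < 1 + u ^+ 2 :> R)%R by rewrite ltr_pwDl ?sqr_ge0.
  set c := Num.sqrt (1 + u ^+ 2)%R.
  have c0 : (0 < c)%R by rewrite sqrtr_gt0.
  have cE : (c ^+ 2 = 1 + u ^+ 2)%R by rewrite sqr_sqrtr // ltW.
  rewrite /K (ge0_integral_scale c0); last 2 first.
  - apply/measurable_EFinP; apply: measurable_funM; last exact: normr_measurable.
    by apply: (measurableT_comp mf); exact: measurable_funX.
  - by move=> s; rewrite lee_fin mulr_ge0.
  have mfc : measurable_fun [set: R] (fun s => (f ((c * s) ^+ 2) * `|c * s|)%R%:E).
    have mc := @mulrl_measurable R setT c.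
    apply/measurable_EFinP; apply: measurable_funM.
      by apply: (measurableT_comp mf); exact: measurable_funX.
    exact: (measurableT_comp (@normr_measurable _ _)).
  rewrite -ge0_integralZl //; last 2 first.
  - by move=> s _; rewrite lee_fin mulr_ge0.
  - by rewrite lee_fin ltW.
  rewrite -ge0_integralZl //; last 3 first.
  - by apply: measurable_funeM.
  - by move=> s _; rewrite -EFinM lee_fin !mulr_ge0 // ltW.
  - by rewrite lee_fin invr_ge0 ltW.
  apply: eq_integral => s _; rewrite -!EFinM /H /=; congr (_%:E).
  rewrite -cE exprMn normrM (gtr0_norm c0) (mulrC (c ^+ 2)%R).
  by field; rewrite gt_eqF.
have mV : measurable_fun [set: R] (fun u => ((1 + u ^+ 2)^-1)%R%:E).
  apply/measurable_EFinP; apply: continuous_measurable_fun.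
  exact: continuous_oneDsqrV.
rewrite ge0_integralZr //.
- by rewrite integralT_oneDsqrV.
- by move=> u _; rewrite lee_fin invr_ge0 addr_ge0 ?sqr_ge0.
- by apply: integral_ge0 => s _; rewrite lee_fin mulr_ge0.
Qed.

End LebesgueScaling.

(** * The law of log2 |z| *)

Section RadialDensities.
Context {R : realType}.
Local Notation mu := (@lebesgue_measure R).

Lemma integral_invr_itv (k a b : R) : 0 < a -> a < b ->
  (\int[mu]_(x in `[a, b]) (k * x^-1)%:E = (k * (ln b - ln a))%:E)%E.
Proof.
move=> a0 ab.
have pos x : a <= x -> 0 < x by exact: lt_le_trans.
have dln (x : R) : 0 < x -> is_derive x 1 (fun y : R => k * ln y) (k * x^-1).
  by move=> x0; have := is_derive1_ln x0 => ?; apply: is_deriveZ.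
have cln (x : R) : 0 < x -> {for x, continuous (fun y : R => k * ln y)}.
  move=> x0; apply: differentiable_continuous; apply/derivable1_diffP.
  by have [] := dln _ x0.
rewrite (continuous_FTC2 (F := fun y : R => k * ln y) ab).
- by rewrite -EFinB mulrBr.
- apply: continuous_in_subspaceT => x; rewrite inE /= in_itv /= => /andP[ax _].
  by apply: cvgM; [exact: cvg_cst|apply: cvgV => //; rewrite gt_eqF // pos].
- split.
  + by move=> x; rewrite in_itv /= => /andP[/ltW/pos/dln[]].
  + by apply: cvg_at_right_filter; exact/cln.
  + by apply: cvg_at_left_filter; apply/cln; rewrite (lt_trans a0).
- move=> x; rewrite in_itv /= => /andP[/ltW/pos x0 _].
  by rewrite derive1E; have [_ ->] := dln _ x0.
Qed.

Lemma measurable_log2 : measurable_fun setT (@log2 R).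
Proof.
by apply: measurable_funM => //; exact: measurable_ln.
Qed.

Lemma measurable_log2_window (a b : R) :
  measurable_fun setT (fun s : R => \1_`[a, b] (log2 s) : R).
Proof.
apply: (measurableT_comp (f := \1_`[a, b] : R -> R)); last exact: measurable_log2.
exact: measurable_indic.
Qed.

(** On [2^a <= |s| <= 2^b] the integrand is at most [k / |s|], whose integral over each sign of [s]
    is [k ln 2 (b - a)]. *)
Lemma integral_log2_window (h : R -> R) (k a b : R) :
  measurable_fun setT h -> (forall s, 0 <= h s) ->
  (forall s, `|s| * h s <= k) -> a < b ->
  (\int[mu]_s (\1_`[a, b] (log2 `|s|) * h s)%:E <=
   (2 * k * ln 2 * (b - a))%:E)%E.
Proof.
move=> mh h0 hk ab.
have l2 := @ln2_gt0 R.
have k0 : 0 <= k by apply: le_trans (hk 0); rewrite normr0 mul0r.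
set A := expR (a * ln 2); set B := expR (b * ln 2).
have A0 : 0 < A by exact: expR_gt0.
have AB : A < B by rewrite ltr_expR ltr_pM2r.
pose g := (fun s : R => (k * s^-1)%:E) \_ `[A, B].
have mg : measurable_fun setT g.
  apply/(measurable_restrictT _ _).1 => //.
  apply/measurable_EFinP.
  apply: subspace_continuous_measurable_fun => //.
  apply: continuous_in_subspaceT => x; rewrite inE /= in_itv /= => /andP[ax _].
  apply: cvgM; [exact: cvg_cst|apply: cvgV => //].
  by rewrite gt_eqF // (lt_le_trans A0).
have g0 s : (0 <= g s)%E.
  rewrite /g patchE; case: ifPn => //; rewrite inE /= in_itv /= => /andP[As _].
  by rewrite lee_fin mulr_ge0 // invr_ge0 (le_trans (ltW A0)).
have gE : (\int[mu]_s g s = (k * ln 2 * (b - a))%:E)%E.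
  by rewrite -integral_mkcond integral_invr_itv // !expRK; congr (_%:E); ring.
have mgN : measurable_fun setT (fun s : R => g (- s)).
  exact: (measurableT_comp mg (@oppr_measurable R setT)).
have -> : ((2 * k * ln 2 * (b - a))%:E = \int[mu]_s (g s + g (- s)%R))%E.
  rewrite ge0_integralD // -ge0_integral_opp // gE -EFinD; congr (_%:E); ring.
apply: ae_ge0_le_integral => //.
- by move=> s _; rewrite lee_fin mulr_ge0.
- apply/measurable_EFinP; apply: measurable_funM => //.
  exact: (measurableT_comp (measurable_log2_window a b) (@normr_measurable _ _)).
- by move=> s _; rewrite adde_ge0.
- exact: emeasurable_funD.
(* Zero is set aside: [log2 0 = 0] may lie in [[a, b]], and the bound on [|s| * h s] does not
   control [h 0]. *)
exists [set 0]; split=> [//||s /= nle]; first exact: lebesgue_measure_set1.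
apply: contrapT => /eqP s0; apply: nle => _.
have s1 : 0 < `|s| by rewrite normr_gt0.
have [abs|] := boolP (log2 `|s| \in `[a, b]); last first.
  by move=> nin; rewrite indicE mem_setE (negbTE nin) mul0r adde_ge0.
have hs : h s <= k * `|s|^-1 by rewrite ler_pdivlMr // mulrC.
have absAB : `|s| \in `[A, B].
  move: abs; rewrite !in_itv /= /log2 ler_pdivlMr // ler_pdivrMr //.
  by rewrite -ler_expR -[_ <= b * _]ler_expR lnK.
rewrite indicE mem_setE abs mul1r.
have [s_ge0|s_lt0] := leP 0 s.
  apply: (@le_trans _ _ (g s)); last by rewrite leeDl.
  by rewrite /g patchE mem_setE -[s in s \in _]ger0_norm // absAB lee_fin -[X in X^-1]ger0_norm.
apply: (@le_trans _ _ (g (- s))); last by rewrite leeDr.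
by rewrite /g patchE mem_setE -ltr0_norm // absAB lee_fin.
Qed.

Lemma circle_density_ge0 (x : R) : 0 <= circle_density x.
Proof. by rewrite invr_ge0 mulr_ge0 ?pi_ge0 // addr_ge0 ?sqr_ge0. Qed.

Lemma continuous_circle_density : continuous (@circle_density R).
Proof.
have -> : @circle_density R = fun x => pi^-1 * (1 + x ^+ 2)^-1.
  by apply/funext => x; rewrite /circle_density invfM.
by move=> x; apply: cvgM; [exact: cvg_cst|exact: continuous_oneDsqrV].
Qed.

Lemma circle_density_mass : (\int[mu]_x (circle_density x)%:E = 1)%E.
Proof.
rewrite (ge0_symfun_integralT circle_density_ge0 continuous_circle_density); last first.
  by move=> x; rewrite /circle_density /= sqrrN.
have p0 := @pi_gt0 R.
under eq_integral do rewrite /circle_density invfM EFinM.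
rewrite ge0_integralZl //.
- rewrite -set_itvcy integral0y_oneDsqr -!EFinM; congr (_%:E).
  by move: (pi : R) p0 => q q0; field; rewrite gt_eqF.
- by rewrite -set_itvcy.
- have mV : measurable_fun [set: R] (fun x : R => (oneDsqr x)^-1).
    by apply: continuous_measurable_fun; exact: continuous_oneDsqrV.
  by apply/measurable_EFinP; exact: measurable_funTS.
- by move=> x _; rewrite lee_fin invr_ge0 addr_ge0 ?sqr_ge0.
- by rewrite lee_fin invr_ge0 ltW.
Qed.

(** [|s| / (pi (1 + s^2)) <= 1 / (2 pi)] because [(1 - |s|)^2 >= 0], so [k = 1 / (2 pi)]. *)
Lemma circle_log2_window (a b : R) : a < b ->
  (\int[mu]_x (\1_`[a, b] (log2 `|x|) * circle_density x)%:E <=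
   (ln 2 / pi * (b - a))%:E)%E.
Proof.
move=> ab; have p0 := @pi_gt0 R.
have -> : ln 2 / pi * (b - a) = 2 * (2 * pi)^-1 * ln 2 * (b - a).
  by move: (pi : R) p0 => q q0; field; rewrite gt_eqF.
apply: integral_log2_window => //.
- exact: continuous_measurable_fun continuous_circle_density.
- exact: circle_density_ge0.
- move=> s; rewrite /circle_density.
  have s0 : 0 <= `|s| by [].
  rewrite -(real_normK (num_real s)) -subr_ge0.
  have -> : (2 * pi)^-1 - `|s| * (pi * (1 + `|s| ^+ 2))^-1 =
     (1 - `|s|) ^+ 2 / (2 * pi * (1 + `|s| ^+ 2)).
    by move: (pi : R) p0 => q q0; field; rewrite !gt_eqF // ltr_pwDl ?sqr_ge0.
  by rewrite divr_ge0 ?sqr_ge0 // !mulr_ge0 ?ltW // ltr_pwDl ?sqr_ge0.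
Qed.

(** Half the density [2 r / (1 + r^2)^2] of the modulus on the sphere, extended evenly, since the
    polar formula integrates over the whole line. *)
Definition radial_density (s : R) : R := `|s| / (1 + s ^+ 2) ^+ 2.

Lemma oneDsqr_neq0 (s : R) : 1 + s ^+ 2 != 0.
Proof. by rewrite gt_eqF // ltr_pwDl ?sqr_ge0. Qed.

Lemma radial_density_ge0 (s : R) : 0 <= radial_density s.
Proof. by rewrite divr_ge0 // sqr_ge0. Qed.

Lemma continuous_radial_density : continuous radial_density.
Proof.
move=> s; apply: cvgM; first exact: norm_continuous.
apply: cvgV; first by rewrite expf_neq0 ?oneDsqr_neq0.
by apply: cvgM; exact: continuous_oneDsqr.
Qed.

Lemma radial_density_mass : (\int[mu]_s (radial_density s)%:E = 1)%E.
Proof.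
rewrite (ge0_symfun_integralT radial_density_ge0 continuous_radial_density); last first.
  by move=> x; rewrite /radial_density /= sqrrN normrN.
pose F (s : R) := - (2^-1 * (1 + s ^+ 2)^-1).
have dF (s : R) : is_derive s 1 F (s / (1 + s ^+ 2) ^+ 2).
  have s0 := oneDsqr_neq0 s.
  have d1 : is_derive s 1 (fun y : R => 1 + y ^+ 2) (2 * s).
    by apply: is_derive_eq; rewrite /GRing.scale /=; ring.

  have d2 := is_deriveV (f := fun y : R => 1 + y ^+ 2) s0 d1.
  by apply: is_derive_eq; rewrite /GRing.scale /=; field; rewrite s0.
rewrite -set_itvcy (@ge0_continuous_FTC2y _ _ F 0 0).
- by rewrite /F expr0n addr0 invr1 mulr1 sub0e -EFinN opprK -EFinM divff.
- by move=> x _; exact: radial_density_ge0.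
- exact: continuous_subspaceT continuous_radial_density.
- rewrite -[X in _ --> X]oppr0; apply: cvgN; rewrite -(mulr0 2^-1).
  apply: cvgM; first exact: cvg_cst.
  apply/gtr0_cvgV0; first by apply: nearW => x; rewrite ltr_pwDl ?sqr_ge0.
  exact: (cvg_comp _ _ cvgr_expr2 (cvg_addrl 1)).
- by move=> x _; have [] := dF x.
- apply: cvg_at_right_filter.
  apply: differentiable_continuous; apply/derivable1_diffP.
  by have [] := dF 0.
- move=> x; rewrite in_itv /= andbT => x0.
  by rewrite derive1E /radial_density gtr0_norm //; have [_ ->] := dF x.
Qed.

Lemma sphere_density_ge0 (x y : R) : 0 <= sphere_density x y.
Proof. by rewrite invr_ge0 mulr_ge0 ?pi_ge0 ?sqr_ge0. Qed.

(** With [|t|] in place of [t] the denominator never vanishes; at [t = x^2 + y^2] this is the sphere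
    density. *)
Lemma measurable_radial_factor :
  measurable_fun setT (fun t : R => (pi * (1 + `|t|) ^+ 2)^-1 : R).
Proof.
have p0 := @pi_gt0 R; apply: continuous_measurable_fun => t; apply: cvgV.
  by rewrite gt_eqF // mulr_gt0 // exprn_gt0 // ltr_pwDl.
apply: cvgM; first exact: cvg_cst.
by apply: cvgM; apply: cvgD => //; (exact: cvg_cst || exact: norm_continuous).
Qed.

(** The factor [pi] of the polar formula cancels that of the sphere density. *)
Lemma integral_sphere_radial (u : R -> R) : measurable_fun setT u ->
  (forall x, 0 <= u x) ->
  (\int[mu \x mu]_w (u (w.1 ^+ 2 + w.2 ^+ 2) * sphere_density w.1 w.2)%:E =
   \int[mu]_s (u (s ^+ 2)%R * radial_density s)%:E)%E.
Proof.
move=> mu_ u0; have p0 := @pi_gt0 R.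
pose f (t : R) := u t * (pi * (1 + `|t|) ^+ 2)^-1.
have mf : measurable_fun setT f.
  by apply: measurable_funM => //; exact: measurable_radial_factor.
have f0 t : 0 <= f t by rewrite mulr_ge0 // invr_ge0 mulr_ge0 ?pi_ge0 ?sqr_ge0.
transitivity (\int[mu \x mu]_w (f (w.1 ^+ 2 + w.2 ^+ 2)%R)%:E)%E.
  by apply: eq_integral => w _; rewrite /f /sphere_density ger0_norm ?addr_ge0 ?sqr_ge0 // addrA.
rewrite ge0_integral_polar // -ge0_integralZl //.
- apply: eq_integral => s _; rewrite -EFinM /f /radial_density ger0_norm ?sqr_ge0 //; congr (_%:E).
  have := oneDsqr_neq0 s; move: (pi : R) p0 => q q0 s0.
  by field; rewrite s0 gt_eqF.
- apply/measurable_EFinP; apply: measurable_funM; last exact: normr_measurable.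
  by apply: (measurableT_comp mf); exact: measurable_funX.
- by move=> s _; rewrite lee_fin mulr_ge0.
- by rewrite lee_fin ltW.
Qed.

Lemma log2_normc (x y : R) :
  log2 (Normc.normc (x +i* y)) = log2 (x ^+ 2 + y ^+ 2) / 2.
Proof.
rewrite /=; set t := x ^+ 2 + y ^+ 2.
have : 0 <= t by rewrite addr_ge0 ?sqr_ge0.
(* At the origin both sides are 0, by the convention [ln 0 = 0]. *)
rewrite le_eqVlt => /predU1P[<-|t0]; first by rewrite sqrtr0 /log2 ln0 // !mul0r.
rewrite -{2}(sqr_sqrtr (ltW t0)) /log2 lnXn ?sqrtr_gt0 // mulr2n; field.
by rewrite gt_eqF // ln2_gt0.
Qed.

Lemma measurable_log2_normc :
  measurable_fun setT (fun w : R * R => log2 (Normc.normc (w.1 +i* w.2))).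
Proof.
have -> : (fun w : R * R => log2 (Normc.normc (w.1 +i* w.2))) =
          (fun w => log2 (w.1 ^+ 2 + w.2 ^+ 2) / 2).
  by apply/funext => w; exact: log2_normc.
apply: measurable_funM => //; apply: (measurableT_comp measurable_log2).
by apply: measurable_funD; apply: measurable_funX.
Qed.

Lemma measurable_sphere_density :
  measurable_fun setT (fun w : R * R => sphere_density w.1 w.2).
Proof.
pose f (t : R) := (pi * (1 + `|t|) ^+ 2)^-1.
have -> : (fun w : R * R => sphere_density w.1 w.2) =
          f \o (fun w => w.1 ^+ 2 + w.2 ^+ 2).
  apply/funext => w; rewrite /f /sphere_density /= ger0_norm ?addrA //.
  by rewrite addr_ge0 ?sqr_ge0.
apply: measurableT_comp; last by apply: measurable_funD; apply: measurable_funX.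
exact: measurable_radial_factor.
Qed.

Lemma sphere_density_mass :
  (\int[mu \x mu]_w (sphere_density w.1 w.2)%:E = 1)%E.
Proof.
rewrite -radial_density_mass.
have := @integral_sphere_radial (fun=> 1) (measurable_cst _) (fun=> ler01).
by under eq_integral do rewrite mul1r; under [RHS]eq_integral do rewrite mul1r.
Qed.

(** [s^2 / (1 + s^2)^2 <= 1/4] because [(1 - s^2)^2 >= 0], so [k = 1/4] in the radial integral. *)
Lemma sphere_log2_window (a b : R) : a < b ->
  (\int[mu \x mu]_w (\1_`[a, b] (log2 (Normc.normc (w.1 +i* w.2))) *
      sphere_density w.1 w.2)%:E <= (ln 2 / 2 * (b - a))%:E)%E.
Proof.
move=> ab.
pose u (t : R) : R := \1_`[a, b] (log2 t / 2).
under eq_integral do rewrite log2_normc.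
rewrite (integral_sphere_radial (u := u)); last 2 first.
- apply: (measurableT_comp (f := \1_`[a, b] : R -> R)); first exact: measurable_indic.
  by apply: measurable_funM => //; exact: measurable_log2.
- by move=> x; rewrite /u indicE.
have uE (s : R) : u (s ^+ 2) = \1_`[a, b] (log2 `|s|).
  have := log2_normc s 0; rewrite expr0n addr0 /u => <-.
  by rewrite /= expr0n addr0 sqrtr_sqr.
under eq_integral do rewrite uE.
have -> : ln 2 / 2 * (b - a) = 2 * 4^-1 * ln 2 * (b - a) by field.
apply: integral_log2_window => //.
- exact: continuous_measurable_fun continuous_radial_density.
- exact: radial_density_ge0.
- move=> s; rewrite /radial_density mulrA -expr2 real_normK ?num_real // -subr_ge0.
  have -> : 4^-1 - s ^+ 2 / (1 + s ^+ 2) ^+ 2 = (1 - s ^+ 2) ^+ 2 / (4 * (1 + s ^+ 2) ^+ 2).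
    by field; rewrite oneDsqr_neq0.
  by rewrite divr_ge0 ?sqr_ge0 // mulr_ge0 ?sqr_ge0.
Qed.

End RadialDensities.

(** * The width of the strip *)

Section Strip.
Context {R : realType}.
Variables (d : nat) (E : R -> R) (D : R).

(** Comparison with every integer [j] replaces the maximum [N] over the real interval, leaving
    finitely many affine inequalities in [lam]. *)
Definition strip (lam : R) : pred nat := fun k => (k <= d)%N &&
  [forall j : 'I_d.+1, E j%:R + lam * j%:R - D <= E k%:R + lam * k%:R].

Definition window (lam : R) : nat * nat :=
  xget (0%N, 0%N) (is_largest_interval (strip lam)).

(** The default [(0, 0)] obeys the same estimates as a genuine largest interval, so both cases are
    carried along. *)
Lemma window_cases lam :
  window lam = (0%N, 0%N) \/ is_largest_interval (strip lam) (window lam).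
Proof. by rewrite /window; case: xgetP => [? ->|_]; [right|left]. Qed.

Lemma window_le lam : ((window lam).1 <= (window lam).2 <= d)%N.
Proof.
have [->//|[le12 sub _]] := window_cases lam.
by rewrite le12; have /andP[] := sub (window lam).2 (introT andP (conj le12 (leqnn _))).
Qed.

(** For [m > 0], the value of [lam] at which [E x + lam * x] has the same height at [j] and at
    [j + m]. *)
Definition chord_slope (m j : nat) : R := (E j%:R - E (j + m)%:R) / m%:R.

(* If k and k + m both lie in the strip, then lam is within D / m of minus the
   slope of E between them; the sum counts such k. *)
Lemma window_width (m : nat) lam : (0 < m)%N ->
  ((window lam).2 - (window lam).1).+1%:R <= m%:R +
    \sum_(j < d.+1 - m)
      \1_`[chord_slope m j - D / m%:R, chord_slope m j + D / m%:R] lam :> R.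
Proof.
move=> m0; set sigma := chord_slope m.
have ge0 (j : nat) :
    0 <= \1_`[sigma j - D / m%:R, sigma j + D / m%:R] lam :> R.
  by rewrite indicE.
(* At most [m] indices are covered by the term [m] alone; this includes the default window, as
   [m > 0]. *)
have wlog_le : ((window lam).2 - (window lam).1 < m)%N ->
    ((window lam).2 - (window lam).1).+1%:R <= m%:R +
    \sum_(j < d.+1 - m) \1_`[sigma j - D / m%:R, sigma j + D / m%:R] lam :> R.
  by move=> lt; rewrite -[leLHS]addr0 lerD ?ler_nat ?sumr_ge0.
have [w0|[_]] := window_cases lam; first by apply: wlog_le; rewrite w0.
have := window_le lam; move: wlog_le; case: (window lam) => l r /=.
move=> wlog_le /andP[lr rd] sub _.
have [/wlog_le //|mrl] := ltnP (r - l) m.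
have mR : 0 < m%:R :> R by rewrite ltr0n.
(* For these [j] both [j] and [j + m] lie in the window, and comparing each with the other bounds
   [lam] on both sides. There are [r - m + 1 - l] of them, which added to [m] gives the width
   [r - l + 1]. *)
have in1 j : (l <= j < (r - m).+1)%N ->
    \1_`[sigma j - D / m%:R, sigma j + D / m%:R] lam = 1 :> R.
  move=> /andP[lj jr].
  have /andP[_ /forallP s1] : strip lam j by apply: sub; lia.
  have /andP[_ /forallP s2] : strip lam (j + m)%N by apply: sub; lia.
  have jd : (j < d.+1)%N by lia.
  have jmd : (j + m < d.+1)%N by lia.
  have /= := s1 (Ordinal jmd); have /= := s2 (Ordinal jd).
  rewrite natrD => e1 e2.
  rewrite indicE mem_setE in_itv /= /sigma /chord_slope -mulrBl -mulrDl.
  rewrite ler_pdivrMr // ler_pdivlMr //.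
  by rewrite natrD (_ : (_ && _) = true) //; apply/andP; split; lra.
rewrite -(big_mkord xpredT (fun j => \1_`[sigma j - D / m%:R, sigma j + D / m%:R] lam : R)).
rewrite (@big_cat_nat _ _ _ l) //=; last by lia.
rewrite (@big_cat_nat _ _ _ (r - m).+1 l) //=; [|lia|lia].
have -> : \sum_(l <= j < (r - m).+1)
    \1_`[sigma j - D / m%:R, sigma j + D / m%:R] lam = ((r - m).+1 - l)%:R :> R.
  by rewrite (eq_big_nat _ _ in1) sumr_const_nat.
apply: (@le_trans _ _ (m%:R + ((r - m).+1 - l)%:R)).
  by rewrite -natrD ler_nat; lia.
rewrite lerD2l addrCA lerDl addr_ge0 //; by apply: sumr_ge0.
Qed.

Lemma measurable_strip k : measurable [set lam | strip lam k].
Proof.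
have [kd|kd] := leqP k d; last first.
  rewrite [X in measurable X](_ : _ = set0) //; apply/seteqP; split => x //=.
  by rewrite /strip leqNgt kd.
rewrite /strip kd /=.
rewrite [X in measurable X](_ : _ = \bigcap_(j in [set: 'I_d.+1])
   [set lam | E j%:R + lam * j%:R - D <= E k%:R + lam * k%:R]); last first.
  by apply/seteqP; split => [x /= /forallP h j _|x h /=]; [exact: h|apply/forallP => j; exact: h].
apply: fin_bigcap_measurable; first exact: finite_finset.
move=> j _; rewrite -[X in measurable X]setTI.
apply: measurable_fun_le => //.
  by apply: measurable_funB => //; apply: measurable_funD => //; exact: measurable_funM.
by apply: measurable_funD => //; exact: measurable_funM.
Qed.

(** The window depends on [lam] only through the finite vector [code] of strip memberships, so every
    preimage is a finite union of measurable sets. *)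
Lemma measurable_window (f : nat * nat -> R) :
  measurable_fun setT (fun lam => f (window lam)).
Proof.
pose code lam : {ffun 'I_d.+1 -> bool} := [ffun k : 'I_d.+1 => strip lam k].
have codeP lam lam' : code lam = code lam' -> window lam = window lam'.
  move=> eq_code; rewrite /window; congr (xget _ (is_largest_interval _)).
  apply/funext => k; have [kd|kd] := leqP k d.
    by have := congr1 (fun g : {ffun _ -> _} => g (inord k)) eq_code; rewrite !ffunE !inordK.
  by rewrite /strip leqNgt kd.
have mcode c : measurable [set lam | code lam = c].
  rewrite [X in measurable X](_ : _ = \bigcap_(k in [set: 'I_d.+1])
     [set lam | strip lam k = c k]); last first.
    apply/seteqP; split => [x /= <- k _ /=|x h /=]; first by rewrite ffunE.
    by apply/ffunP => k; rewrite ffunE; exact: h.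
  apply: fin_bigcap_measurable; first exact: finite_finset.
  move=> k _; case: (c k); first exact: measurable_strip.
  rewrite [X in measurable X](_ : _ = ~` [set lam | strip lam k]).
    by apply: measurableC; exact: measurable_strip.
  by apply/seteqP; split => [x /= ->//|x /= /negP/negbTE].
move=> _ Y mY; rewrite setTI.
rewrite [X in measurable X](_ : _ =
    \bigcup_(c in [set c | exists2 lam, code lam = c & Y (f (window lam))])
      [set lam | code lam = c]); last first.
  apply/seteqP; split => [x Yx|x [c [y yc Yy] /= xc]].
    by exists (code x) => //; exists x.
  by rewrite /= (codeP x y) // xc yc.
by apply: fin_bigcup_measurable => // ; exact: finite_finset.
Qed.

End Strip.

(** * Means of functions dominated by a constant plus a count of windows *)

Section Mean.
Context {R : realType}.

(** Integration term by term: each window has length [2 * del], hence mass at most [K * (2 * del)].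
    The measure is abstract so as to serve both the sphere and the circle. *)
Lemma radial_mean (dsp : measure_display) (X : measurableType dsp)
    (mu : {measure set X -> \bar R}) (rho lam : X -> R) (G : R -> R)
    (K del c M : R) (n : nat) (sigma : nat -> R) :
  measurable_fun setT rho -> (forall w, 0 <= rho w) ->
  (\int[mu]_w (rho w)%:E = 1)%E ->
  measurable_fun setT lam ->
  (forall a b : R, a < b ->
    (\int[mu]_w (\1_`[a, b] (lam w) * rho w)%:E <= (K * (b - a))%:E)%E) ->
  measurable_fun setT G -> (forall x, 0 <= G x) ->
  0 < del -> 0 <= c -> 0 <= M ->
  (forall x, G x <= c + M * \sum_(j < n) \1_`[sigma j - del, sigma j + del] x) ->
  mu.-integrable setT (fun w => (G (lam w) * rho w)%:E) /\
  (\int[mu]_w (G (lam w) * rho w)%:E <= (c + M * (n%:R * (K * (2 * del))))%:E)%E.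
Proof.
move=> mrho rho0 rho1 mlam Kab mG G0 del0 c0 M0 Gle.
pose I (j : 'I_n) (w : X) := (\1_`[sigma j - del, sigma j + del] (lam w) * rho w)%:E.
have I0 j w : (0 <= I j w)%E by rewrite lee_fin mulr_ge0 // indicE.
have mI j : measurable_fun setT (I j).
  apply/measurable_EFinP; apply: measurable_funM => //.
  exact: (measurableT_comp (f := \1_`[sigma j - del, sigma j + del] : R -> R)).
have mGr : measurable_fun setT (fun w => (G (lam w) * rho w)%:E).
  by apply/measurable_EFinP; apply: measurable_funM => //; exact: measurableT_comp.
have Gr0 w : (0 <= (G (lam w) * rho w)%:E)%E by rewrite lee_fin mulr_ge0.
have main : (\int[mu]_w (G (lam w) * rho w)%:E <=
    (c + M * (n%:R * (K * (2 * del))))%:E)%E.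
  apply: (@le_trans _ _ (\int[mu]_w (c%:E * (rho w)%:E + M%:E * \sum_(j < n) I j w))%E).
    apply: ge0_le_integral => //.
    - apply: emeasurable_funD; apply: measurable_funeM; first exact/measurable_EFinP.
      exact: emeasurable_sum.
    - move=> w _; rewrite /I sumEFin -!EFinM -EFinD lee_fin -mulr_suml mulrA -mulrDl.
      exact: ler_wpM2r.
  rewrite ge0_integralD //; last 4 first.
  - by move=> w _; rewrite mule_ge0 ?lee_fin.
  - by apply: measurable_funeM; exact/measurable_EFinP.
  - by move=> w _; rewrite mule_ge0 ?lee_fin // sume_ge0.
  - by apply: measurable_funeM; exact: emeasurable_sum.
  rewrite !ge0_integralZl //; last 4 first.
  - exact: emeasurable_sum.
  - by move=> w _; rewrite sume_ge0.
  - exact/measurable_EFinP.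
  - by move=> w _; rewrite lee_fin.
  rewrite rho1 mule1 ge0_integral_sum // EFinD leeD2l // EFinM lee_wpmul2l ?lee_fin //.
  apply: (@le_trans _ _ (\sum_(j < n) (K * (2 * del))%:E)%E); last first.
    by rewrite sumEFin sumr_const card_ord lee_fin (mulr_natl (K * _)).
  apply: lee_sum => j _; apply: le_trans (Kab _ _ _) _; first by lra.
  by rewrite lee_fin le_eqVlt; apply/orP; left; apply/eqP; ring.
split => //; apply/integrableP; split => //.
under eq_integral do rewrite gee0_abs //.
by apply: le_lt_trans main _; rewrite ltry.
Qed.

End Mean.

(** * The time of the algorithm *)

Section EvaluationTime.
Context {R : realType}.
Implicit Types (P : {poly R[i]}) (p : nat).

Lemma normc_real (x : R) : Normc.normc x%:C = `|x|.
Proof. by rewrite /= expr0n addr0 sqrtr_sqr. Qed.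

Definition strip_depth p (d : nat) : R :=
  p%:R + (1 + (Num.floor (log2 (d%:R : R)))%:~R) + 3.

Lemma thresholdE p (d : nat) (y : R) : (1 <= d)%N ->
  threshold p d y = (y - strip_depth p d)%:E.
Proof.
move=> d1; rewrite /threshold /scale pnatr_eq0 eqn0Ngt d1 /=.
have -> : (d%:R : R[i]) = (d%:R : R)%:C by rewrite rmorph_nat.
rewrite normc_real ger0_norm // -!EFinB; congr (_%:E).
by rewrite /strip_depth; ring.
Qed.

Lemma strip_depth_gt0 p (d : nat) : (1 <= d)%N -> 0 < strip_depth p d.
Proof.
move=> d1; have l0 := @log2_ge0 R d d1.
have f0 : 0 <= (Num.floor (log2 (d%:R : R)))%:~R :> R by rewrite ler0z floor_ge0.
by have p0 : 0 <= p%:R :> R by []; rewrite /strip_depth; lra.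
Qed.

(** The 4 of the final bound is the 3 of the threshold plus the 1 of the scale. *)
Lemma strip_depth_le p (d : nat) : strip_depth p d <= p%:R + log2 d%:R + 4.
Proof. by have := ge_floor (log2 (d%:R : R)); rewrite /strip_depth; lra. Qed.

(* The minimum of the cover and of a line above it at the integers is again a
   concave majorant, so the line is above the cover everywhere. *)
Lemma concave_cover_le_line P (lam N : R) : P`_0 != 0 -> P != 0 ->
  (forall j, (j <= degree P)%N -> concave_cover P j%:R + lam * j%:R <= N) ->
  {in `[0, (degree P)%:R]%R, forall x, concave_cover P x + lam * x <= N}.
Proof.
move=> P0 Pn0 jN x xd.
have [[/concave_functionP cE mE] minE] := concave_coverP P0 Pn0.
pose h y := Num.min (concave_cover P y) (N - lam * y).
suff ch : concave_majorant P h.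
  have := minE _ ch x xd; rewrite /h le_min => /andP[_]; lra.
split.
  apply/concave_functionP => y z t Dy Dz /andP[t0 t1].
  have u0 : 0 <= 1 - t by rewrite subr_ge0.
  rewrite /h le_min; apply/andP; split.
    apply: le_trans (cE y z t Dy Dz _); last by rewrite t0.
    by apply: lerD; apply: ler_wpM2l => //; rewrite ge_min lexx.
  have hy : h y <= N - lam * y by rewrite ge_min lexx orbT.
  have hz : h z <= N - lam * z by rewrite ge_min lexx orbT.
  rewrite -/(h y) -/(h z); nra.
move=> k kd; have := mE k kd; rewrite /scale; case: ifPn => [_ _|_]; first by rewrite leNye.
rewrite !lee_fin /h le_min => kE; rewrite kE /= (le_trans kE) // lerBrDr.
exact: jN.
Qed.

Section Cover.
Variables (P : {poly R[i]}) (d p : nat).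
Hypotheses (szP : size P = d.+1) (d1 : (1 <= d)%N) (P0 : P`_0 != 0).
Local Notation E := (concave_cover P).

Lemma degreeE : degree P = d. Proof. by rewrite /degree szP. Qed.

(** The best integer [j0] maximizes over the whole interval by [concave_cover_le_line]. So a
    maximizer exists, and the one chosen, integer or not, has the value at [j0]. *)
Lemma maximizer_value (lam : R) :
  let k := xget 0 (is_maximizer `[0, d%:R] (fun x => E x + lam * x)) in
  (exists j : 'I_d.+1, E k + lam * k = E j%:R + lam * j%:R) /\
  (forall j, (j <= d)%N -> E j%:R + lam * j%:R <= E k + lam * k).
Proof.
set g := fun x => E x + lam * x; set k := xget _ _.
have [j0 j0max] : exists j0 : 'I_d.+1, forall j : 'I_d.+1, g j%:R <= g j0%:R.
  case: (@arg_maxP _ _ _ (@ord0 d) xpredT (fun j : 'I_d.+1 => g j%:R) isT) => j0 _ h.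
  by exists j0 => j; exact: h.
have jle j : (j <= d)%N -> g j%:R <= g j0%:R.
  by move=> jd; exact: (j0max (Ordinal (jd : (j < d.+1)%N))).
have in_d (j : 'I_d.+1) : `[0, d%:R]%classic (j%:R : R).
  by rewrite /= in_itv /= ler0n ler_nat -ltnS ltn_ord.
have Pn0 : P != 0 by rewrite -size_poly_eq0 szP.
have le_max y : `[0, d%:R]%classic y -> g y <= g j0%:R.
  have := @concave_cover_le_line P lam (g j0%:R) P0 Pn0.
  by rewrite degreeE => /(_ jle) le_g; exact: le_g.
have [kd kmax] : is_maximizer `[0, d%:R] g k.
  by apply: (@xgetPex _ _ (is_maximizer `[0, d%:R] g)); exists j0%:R.
split; last by move=> j jd; apply: (kmax); exact: (in_d (Ordinal (jd : (j < d.+1)%N))).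
exists j0; apply/le_anti; rewrite kmax // andbT.
exact: le_max.
Qed.

Lemma in_stripE (lam : R) :
  let k := xget 0 (is_maximizer `[0, d%:R] (fun x => E x + lam * x)) in
  in_strip d p E lam (E k + lam * k) = strip d E (strip_depth p d) lam.
Proof.
move=> k; have [[j0 kj0] kmax] := maximizer_value lam; rewrite -/k in kj0 kmax.
apply/funext => i; rewrite /in_strip /strip; case: leqP => //= id_.
rewrite thresholdE // lee_fin; apply/idP/forallP => [le_i j|/(_ j0)].
  by apply: le_trans le_i; rewrite lerD2r kmax // -ltnS.
by rewrite kj0.
Qed.

(** Steps (a) to (d) charge [1 + log2 d + 1 + 2 log2 d]; the rest depends on [z] only through
    [log2 |z|]. *)
Lemma FPE_timeE fl (Mp : R) z :
  let w := window d E (strip_depth p d) (log2 (Normc.normc z)) in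
  FPE_time fl p Mp P z = 2 + 3 * log2 d%:R + (@eval_cost R w.1 w.2)%:R * Mp.
Proof.
move=> w; rewrite /FPE_time /FPE_evaluate /= degreeE.
rewrite in_stripE -/(window d E (strip_depth p d) _) -/w.
set b := fun _ => _; have := eval_range_count fl b z w.1 w.2.
case: eval_range => y c /= ->.
rewrite /time /outcome /bind /charge /=; ring.
Qed.

End Cover.

Lemma FPE_precondition_time P p d : size P = d.+1 ->
  time (FPE_precondition P p) = d%:R + 2 * d%:R * log2 d%:R.
Proof.
move=> szP; rewrite /FPE_precondition /bind /charge /time /outcome /= /degree szP /=.
ring.
Qed.

(** The coefficients take [2 (d + 1) (p + w)] bits and the table at most [5 (d + 1) w]; then
    [d + 1 <= 2 d p] and [(d + 1) p <= 2 d p]. *)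
Lemma FPE_memory_le (w : nat) P p d :
  size P = d.+1 -> (1 <= d)%N -> (0 < p)%N ->
  (FPE_memory w P p <= (14 * w + 4) * (d * p))%N.
Proof.
move=> szP d1 p0; rewrite /FPE_memory /= size_sort !size_map size_iota /degree szP /=.
have le_size (q : pred nat) m n : (size [seq k <- iota m n | q k] <= n)%N.
  by rewrite size_filter (leq_trans (count_size _ _)) // size_iota.
(* Index 0 is always a vertex, so only [1, ..., d] remain to be counted. *)
have := le_size (is_vertex d (concave_cover P)) 1%N d.
have := le_size (fun k => (threshold p (degree P) (concave_cover P k%:R) <= scale P`_k)%E)
  0%N (degree P).+1.
rewrite -/(good_set P p (concave_cover P)) /degree szP /=.
move: (size _) (size _) => a b ale ble.
have : (d.+1 <= 2 * (d * p))%N by nia.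
have : (d.+1 * p <= 2 * (d * p))%N by nia.
nia.
Qed.

End EvaluationTime.

(** * Mean values *)

Section MeanTime.
Context {R : realType}.

(** [exp 0.78 >= 1.195^4 > 2]. The value 0.78 is what the circle requires when [pi] is bounded below
    by 2. *)
Lemma ln2_le : ln 2 <= 78 / 100 :> R.
Proof.
rewrite -[leRHS]expRK ler_ln ?posrE ?expR_gt0 //.
have -> : 78 / 100 = 4%:R * (195 / 1000) :> R by field.
rewrite expRM_natl.
have e1 : 0 <= 1 + 195 / 1000 :> R by lra.
have e2 : 1 + 195 / 1000 <= expR (195 / 1000) :> R by exact: expR_ge1Dx.
apply: (@le_trans _ _ ((1 + 195 / 1000) ^+ 4)); first by rewrite !exprS expr0; lra.
by rewrite lerXn2r // nnegrE ?expR_ge0.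
Qed.

(* The left-hand side is about m + c^2 d L / (4 m), minimal at
   m = sqrt (c^2 d L / 4). *)
Lemma cost_balance (c L D K : R) (d : nat) : 0 < c -> 3 <= c ^+ 2 ->
  0 <= K -> 8 * K <= c ^+ 2 -> 5 <= L -> 0 < D -> D <= L -> c ^+ 2 * L <= d%:R ->
  exists m : nat, [/\ (0 < m)%N, (m <= d.+1)%N &
    m%:R + (d.+1 - m)%:R * (K * (2 * (D / m%:R))) < c * Num.sqrt (d%:R * L)].
Proof.
move=> c0 c3 K0 Kc L5 D0 DL Ld.
pose A := c ^+ 2 / 4; pose s := Num.sqrt (A * L * d%:R).
have L0 : 0 < L by lra.
have AL : 15 / 4 <= A * L by rewrite /A; nra.
have d15 : 15 <= d%:R :> R by nra.
have ALd : A * L <= d%:R by rewrite /A; lra.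
have s0 : 0 <= s by rewrite sqrtr_ge0.
have sE : s ^+ 2 = A * L * d%:R by rewrite sqr_sqrtr // mulr_ge0 //; lra.
have s2 : 2 <= s.
  by rewrite -(@ler_pXn2r _ 2) ?nnegrE // sE; nra.
have sd : s <= d%:R.
  by rewrite -(@ler_pXn2r _ 2) ?nnegrE // sE expr2 ler_wpM2r.
(* The choice [m = floor s + 1] gives [s < m <= s + 1], and [m <= d + 1] since [s <= d]. *)
have := truncn_itv s0 => /andP[ts st].
set t := Num.truncn s in ts st.
have td : (t <= d)%N by rewrite -(ler_nat R) (le_trans ts).
exists t.+1; split => //.
set m : R := t.+1%:R in st *.
have m0 : 0 < m by rewrite ltr0n.
have ms : m <= s + 1 by rewrite /m -natr1 lerD2r.
have KDm : K * (2 * (D / m)) <= A * L / m.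
  rewrite !mulrA ler_pM2r ?invr_gt0 // /A.
  have : K * 2 * D <= c ^+ 2 / 4 * D by apply: ler_wpM2r; lra.
  have : c ^+ 2 / 4 * D <= c ^+ 2 / 4 * L by apply: ler_wpM2l; lra.
  lra.
have -> : c * Num.sqrt (d%:R * L) = 2 * s.
  rewrite /s /A.
  have -> : c ^+ 2 / 4 * L * d%:R = (c / 2) ^+ 2 * (d%:R * L) by field.
  rewrite (sqrtrM _ (sqr_ge0 (c / 2))) sqrtr_sqr ger0_norm; first by field.
  by lra.
apply: (@le_lt_trans _ _ (m + (d.+1 - t.+1)%:R * (A * L / m))).
  by rewrite lerD2l ler_wpM2l.
have -> : (d.+1 - t.+1)%:R = d%:R + 1 - m :> R.
  by rewrite natrB // -natr1.
have -> : m + (d%:R + 1 - m) * (A * L / m) = m + s ^+ 2 / m + A * L / m - A * L.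
  by rewrite sE; field; rewrite gt_eqF.
have h1 : s ^+ 2 / m <= s by rewrite expr2 ler_pdivrMr // ler_wpM2l // ltW.
have h2 : A * L / m <= A * L / 2.
  by rewrite ler_wpM2l ?lef_pV2 ?posrE //; lra.
(* The total is at most [(s + 1) + s + A L / 2 - A L], below [2 s] because [A L >= 15/4 > 2]. *)
move: ms h1 h2 AL; move: (s ^+ 2 / m) (A * L / m) (A * L) => u v w.
clearbody m s; lra.
Qed.

Lemma mean_time_lt (dsp : measure_display) (X : measurableType dsp)
    (mu : {measure set X -> \bar R}) (rho lam : X -> R) (K c : R)
    (P : {poly R[i]}) (d p : nat) (Mp : R) :
  measurable_fun setT rho -> (forall w, 0 <= rho w) ->
  (\int[mu]_w (rho w)%:E = 1)%E ->
  measurable_fun setT lam ->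
  (forall a b : R, a < b ->
    (\int[mu]_w (\1_`[a, b] (lam w) * rho w)%:E <= (K * (b - a))%:E)%E) ->
  0 < c -> 3 <= c ^+ 2 -> 0 <= K -> 8 * K <= c ^+ 2 ->
  (1 <= d)%N -> (0 < p)%N -> 0 < Mp ->
  let G x := let w := window d (concave_cover P) (strip_depth p d) x in
    2 + 3 * log2 d%:R + (@eval_cost R w.1 w.2)%:R * Mp in
  mu.-integrable setT (fun w => (G (lam w) * rho w)%:E) /\
  (\int[mu]_w (G (lam w) * rho w)%:E < (2 + 3 * log2 d%:R +
    (2 * log2 d%:R + c * Num.sqrt (d%:R * (p%:R + log2 d%:R + 4))) * Mp)%:E)%E.
Proof.
move=> mrho rho0 rho1 mlam Kab c0 c3 K0 Kc d1 p0 Mp0 G.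
set E := concave_cover P; set D := @strip_depth R p d.
have D0 : 0 < D by exact: strip_depth_gt0.
set L := p%:R + log2 d%:R + 4.
have DL : D <= L by exact: strip_depth_le.
have l0 := @log2_ge0 R d d1.
have p1 : 1 <= p%:R :> R by rewrite ler1n.
have L5 : 5 <= L by rewrite /L; lra.
have dR : 1 <= d%:R :> R by rewrite ler1n.
have G0 x : 0 <= G x by rewrite /G addr_ge0 ?mulr_ge0 ?(ltW Mp0) //; lra.
have mG : measurable_fun setT G.
  exact: (measurable_window d E D (fun w => 2 + 3 * log2 d%:R + (@eval_cost R w.1 w.2)%:R * Mp)).
(* If [d < c^2 L] then [d^2 < c^2 d L], so the worst-case count [d] suffices; [radial_mean] is
   applied with an empty sum. *)
have [dL|Ld] := ltP (d%:R : R) (c ^+ 2 * L).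
  have G1 x : G x <= 2 + 3 * log2 d%:R + d%:R * Mp + 0 *
      \sum_(j < 0) \1_`[(j : nat)%:R - 1, (j : nat)%:R + 1] x.
    rewrite mul0r addr0 lerD2l ler_pM2r // ler_nat.
    have /andP[wle wd] := window_le d E D x.
    exact: leq_trans (eval_cost_le wle) wd.
  have a0 : 0 <= 2 + 3 * log2 d%:R + d%:R * Mp.
    by have := mulr_gt0 (lt_le_trans ltr01 dR) Mp0; lra.
  have [iG leG] := radial_mean (sigma := GRing.natmul 1) mrho rho0 rho1 mlam
    Kab mG G0 ltr01 a0 (lexx 0) G1.
  split => //; apply: le_lt_trans leG _.
  rewrite lte_fin mul0r addr0 ltrD2l ltr_pM2r //.
  suff : d%:R < c * Num.sqrt (d%:R * L) by lra.
  rewrite -(@ltr_pXn2r _ 2) ?nnegrE ?mulr_ge0 ?sqrtr_ge0 //; last exact: ltW.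
  rewrite exprMn sqr_sqrtr; last by rewrite mulr_ge0 //; lra.
  by rewrite mulrCA expr2 ltr_pM2l //; lra.
have [m [m0 md mlt]] := cost_balance c0 c3 K0 Kc L5 D0 DL Ld.
have del0 : 0 < D / m%:R by rewrite divr_gt0 // ltr0n.
have a0 : 0 <= 2 + 3 * log2 d%:R + (2 * log2 d%:R + m%:R) * Mp.
  by rewrite addr_ge0 ?mulr_ge0 ?(ltW Mp0) ?addr_ge0 //; lra.
(* For large [d], the width estimate at the balanced [m] puts the cost in the form required by
   [radial_mean]. *)
have Gle x : G x <= 2 + 3 * log2 d%:R + (2 * log2 d%:R + m%:R) * Mp + Mp *
   \sum_(j < d.+1 - m)
      \1_`[chord_slope E m j - D / m%:R, chord_slope E m j + D / m%:R] x.
  rewrite -addrA lerD2l [Mp * _]mulrC -mulrDl ler_pM2r // -addrA.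
  apply: le_trans (eval_cost_log2 d1 (window_le d E D x)) _.
  by rewrite lerD2l; exact: window_width.
have [iG leG] := radial_mean (sigma := chord_slope E m) mrho rho0 rho1 mlam
  Kab mG G0 del0 a0 (ltW Mp0) Gle.
split => //; apply: le_lt_trans leG _.
rewrite lte_fin -addrA ltrD2l [Mp * _]mulrC -mulrDl ltr_pM2r // -addrA ltrD2l.
exact: mlt.
Qed.

End MeanTime.

(** * Memory, preconditioning, mean and worst-case bounds combined *)

Theorem theorem4 (R : realType) :
  (forall w : nat, exists C : nat,
     forall (P : {poly R[i]}) (d p : nat),
       size P = d.+1 -> (1 <= d)%N -> P`_0 != 0 -> (0 < p)%N ->
       (FPE_memory w P p <= C * (d * p))%N) /\
  (forall (P : {poly R[i]}) (d p : nat) (M : nat -> R)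
          (fl : R[i] -> R[i] -> R[i] -> R[i]),
     size P = d.+1 -> (1 <= d)%N -> P`_0 != 0 -> (0 < p)%N -> 0 < M p ->
     let T := FPE_time fl p (M p) P in
     let bound (c : R) :=
       2 + 3 * log2 d%:R +
       (2 * log2 d%:R + c * Num.sqrt (d%:R * (p%:R + log2 d%:R + 4))) * M p in
     [/\ time (FPE_precondition P p) = d%:R + 2 * d%:R * log2 d%:R,
         sphere_integrable T /\
         (sphere_mean T < (bound (19046 / 10000))%:E)%E,
         P \is a polyOver Num.real ->
         circle_integrable (fun x : R => T x%:C) /\
         (circle_mean (fun x : R => T x%:C) < (bound (17673 / 10000))%:E)%E &
         forall z : R[i], z != 0 -> T z <= 2 + 3 * log2 d%:R + M p * d%:R]).
Proof.
split.
  move=> w; exists (14 * w + 4)%N => P d p szP d1 _ p0.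
  exact: FPE_memory_le.
move=> P d p M fl szP d1 P0 p0 Mp0 T bound.
have TE : T = fun z => _ := funext (FPE_timeE p szP d1 P0 fl (M p)).
have l2 := @ln2_gt0 R; have l2le := @ln2_le R.
have pi2 := @pi_ge2 R.
split.
- exact: FPE_precondition_time.
- have mrho : measurable_fun setT (fun w : R * R => sphere_density w.1 w.2).
    exact: measurable_sphere_density.
  have := @mean_time_lt R _ _ (lebesgue_measure \x lebesgue_measure)%E
    (fun w : R * R => sphere_density w.1 w.2)
    (fun w : R * R => log2 (Normc.normc (w.1 +i* w.2))) (ln 2 / 2)
    (19046 / 10000) P d p (M p) mrho (fun w => sphere_density_ge0 w.1 w.2)
    sphere_density_mass measurable_log2_normc (@sphere_log2_window R)
    _ _ _ _ d1 p0 Mp0.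
  (* Here [8 K = 4 ln 2 <= 3.12], below [1.9046^2]. *)
  case; [lra|lra|lra|lra|move=> iT ltT].
  by rewrite TE.
- move=> _.
  have mlam : measurable_fun setT (fun x : R => log2 `|x|).
    exact: (measurableT_comp (@measurable_log2 R) (@normr_measurable _ _)).
  have mrho : measurable_fun setT (@circle_density R).
    exact: continuous_measurable_fun (@continuous_circle_density R).
  have := @mean_time_lt R _ _ lebesgue_measure (@circle_density R) (fun x => log2 `|x|)
    (ln 2 / pi) (17673 / 10000) P d p (M p) mrho (@circle_density_ge0 R)
    circle_density_mass mlam (@circle_log2_window R) _ _ _ _ d1 p0 Mp0.
  case; [lra|lra| | |move=> iT ltT].
  + by rewrite divr_ge0 // ltW // pi_gt0.
  (* [8 ln 2 <= 6.24 < 2 * 1.7673^2], and [pi >= 2]. *)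
  + by rewrite mulrA ler_pdivrMr ?pi_gt0 //; nra.
  have -> : (fun x : R => T x%:C) = fun x =>
      let w := window d (concave_cover P) (strip_depth p d) (log2 `|x|) in
      2 + 3 * log2 d%:R + (@eval_cost R w.1 w.2)%:R * M p.
    by apply/funext => x; rewrite TE normc_real.
  by [].
- move=> z _; rewrite TE lerD2l mulrC ler_pM2l // ler_nat.
  have /andP[wle wd] := window_le d (concave_cover P) (strip_depth p d) (log2 (Normc.normc z)).
  exact: leq_trans (eval_cost_le wle) wd.
Qed.
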